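(* Consider the nonlinear system $\dot x(t)=f(t,x(t),\varepsilon(t))$, $x(0)=x_0$, $t\ge 0$, with $x(t)\in\mathbf{R}^n$. Assume that there exist a positive definite, radially unbounded and continuously differentiable function $V:\mathbf{R}^n\to[0,\infty)$ and constants $\omega>0$ and $\alpha\in(0,1)$ such that, along the solutions of the system, $$\dot V(x(t))\le-\frac{\omega}{\alpha}\,\varepsilon(t)\,V^{1-\alpha}(x(t)),\quad V(x(0))=V_0,\qquad \dot\varepsilon(t)=\omega V^{\alpha}(x(t)),\quad \varepsilon(0)=\varepsilon_0\ge 0.$$ Then the system is fixed-time stable (FxTS) with the settling time $\pi/(2\omega)$. In addition, if along the solutions of the system $$\dot V(x(t))=-\frac{\omega}{\alpha}\,\varepsilon(t)\,V^{1-\alpha}(x(t)),\quad V(x(0))=V_0,\qquad \dot\varepsilon(t)=\omega V^{\alpha}(x(t)),\quad \varepsilon(0)=0,$$ then the system is exact fixed-time stable (EFxTS) with the settling time $\pi/(2\omega)$.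
   Context: General setting: the system is $\dot x(t)=f(t,x(t),\varepsilon(t))$, $x(0)=x_0$, $t\ge 0$, with state $x(t)\in\mathbf{R}^n$, coupled with $\dot\varepsilon(t)=g(t,x(t))$, $\varepsilon(0)=\varepsilon_0$, $\varepsilon(t)\in\mathbf{R}^m$ (in this lemma $\varepsilon$ is scalar, $m=1$, and $g(t,x)=\omega V^{\alpha}(x)$), where $f,g$ are locally essentially bounded and locally measurable, and $x=0$ is an equilibrium of the $x$-system. Here $\varepsilon$ is an auxiliary variable with given initial value $\varepsilon_0$; stability refers only to the component $x$. Solutions are understood in the sense of Filippov (absolutely continuous solutions $\xi=[x^{\mathrm T},\varepsilon^{\mathrm T}]^{\mathrm T}$ of the Filippov differential inclusion associated with the right-hand side), and stability is strong stability, i.e., it concerns all solutions. $\dot V(x(t))$ is the time derivative of $V$ along solutions. Definitions. The $x$-system is: - finite-time stable (FTS) if it is globally stable (in the sense of Lyapunov) and there is a function $T_0:\mathbf{R}^n\to[0,\infty)$ such that $x(t)=0$ for all $t\ge T_0(x_0)$; - fixed-time stable (FxTS) with the settling time $T<\infty$ if it is FTS and $T_0(x_0)\le T$ for all $x_0$; - exact fixed-time stable (EFxTS) with the settling time $T<\infty$ if it is FxTS and $T_0(x_0)=T$ for all $x_0\neq 0$, where $T_0(x_0)$ is the actual settling time, i.e., for $x_0\ne0$ each solution satisfies $\inf\{\tau\ge 0: x(t)=0\ \forall t\ge\tau\}=T$. *)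

(* Defs.v *)
From HB Require Import structures.
From mathcomp Require Import all_boot all_order all_algebra.
From mathcomp Require Import all_classical all_reals all_analysis.

Set Implicit Arguments.
Unset Strict Implicit.
Unset Printing Implicit Defensive.

Import Order.TTheory GRing.Theory Num.Theory.
Import numFieldNormedType.Exports.

Local Open Scope classical_set_scope.
Local Open Scope ring_scope.

(* Vectors of R^k are row vectors 'rV[R]_k.  The library norm on them is the
   sup norm; it is equivalent to the Euclidean one, and every notion below is
   insensitive to the choice between equivalent norms. *)

Section LebesgueRk.
Variables (R : realType) (k : nat).
Implicit Types (a b : 'rV[R]_k) (A N : set 'rV[R]_k).

Definition box a b : set 'rV[R]_k :=
  [set p | forall i, a 0 i <= p 0 i <= b 0 i].

Definition box_vol a b : R := \prod_(i < k) (b 0 i - a 0 i).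

(* The library has no Lebesgue measure on R^k.  The index set D only serves to
   allow countable families that are finite or empty. *)
Definition null_set N : Prop :=
  forall eta : R, 0 < eta ->
    exists (D : set nat) (a b : nat -> 'rV[R]_k),
      [/\ forall j i, a j 0 i <= b j 0 i,
          N `<=` \bigcup_(j in D) box (a j) (b j) &
          (\esum_(j in D) (box_vol (a j) (b j))%:E <= eta%:E)%E].

Definition lebesgue_measurable A : Prop :=
  exists2 B : set 'rV[R]_k, <<s [set U : set 'rV[R]_k | open U] >> B &
    null_set ((A `\` B) `|` (B `\` A)).

End LebesgueRk.

Section Regularity.
Variables (R : realType) (k l : nat) (h : R -> 'rV[R]_k -> 'rV[R]_l).

(* h on [0, oo) x R^k, the point (t, xi) being encoded as row_mx t xi. *)
Let H (p : 'rV[R]_(1 + k)) : 'rV[R]_l := h (lsubmx p 0 0) (rsubmx p).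

Let dom (r : R) : set 'rV[R]_(1 + k) :=
  [set p | 0 <= lsubmx p 0 0 /\ `|p| <= r].

Definition locally_ess_bounded : Prop :=
  forall r : R, exists M : R, null_set (dom r `&` [set p | M < `|H p|]).

Definition locally_measurable : Prop :=
  forall (r : R) (U : set 'rV[R]_l), open U ->
    lebesgue_measurable (dom r `&` H @^-1` U).

End Regularity.

Section Filippov.
Variables (R : realType) (k : nat) (h : R -> 'rV[R]_k -> 'rV[R]_k).

Definition conv_hull (A : set 'rV[R]_k) : set 'rV[R]_k :=
  \bigcap_(C in [set C : set 'rV[R]_k | convex_set C /\ A `<=` C]) C.

Definition filippov_set (t : R) (xi : 'rV[R]_k) : set 'rV[R]_k :=
  \bigcap_(delta in [set d : R | 0 < d]) \bigcap_(N in @null_set R k)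
    closure (conv_hull (h t @` (ball xi delta `\` N))).

Definition abs_continuous (xi : R -> 'rV[R]_k) (c d : R) : Prop :=
  forall eta : R, 0 < eta -> exists2 delta : R, 0 < delta &
    forall (q : nat) (u v : 'I_q -> R),
      (forall i, c <= u i /\ u i <= v i /\ v i <= d) ->
      (forall i j, i != j -> v i <= u j \/ v j <= u i) ->
      \sum_(i < q) (v i - u i) < delta ->
      \sum_(i < q) `|xi (v i) - xi (u i)| < eta.

Definition horizon (b : \bar R) : set R :=
  [set t | 0 <= t /\ (t%:E < b)%E].

(* xi solves xi' \in filippov_set t xi on [0, b), where 0 < b <= +oo; the
   values of xi outside [0, b) are irrelevant. *)
Definition filippov_solution (b : \bar R) (xi0 : 'rV[R]_k)
    (xi : R -> 'rV[R]_k) : Prop :=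
  [/\ (0 < b)%E,
      xi 0 = xi0,
      forall c, horizon b c -> abs_continuous xi 0 c &
      {ae lebesgue_measure, forall t : R, 0 < t -> (t%:E < b)%E ->
         derivable xi t 1 /\ filippov_set t (xi t) (derive1 xi t)}].

End Filippov.

(* The coupled system x' = f(t, x, eps), eps' = g(t, x), with x in R^n and a
   scalar auxiliary variable eps; its state is xi = row_mx x eps. *)
Section CoupledSystem.
Variables (R : realType) (n : nat).
Variables (f : R -> 'rV[R]_n -> R -> 'rV[R]_n) (g : R -> 'rV[R]_n -> R).

Definition state (x : 'rV[R]_n) (e : R) : 'rV[R]_(n + 1) :=
  row_mx x (const_mx e).

Definition xpart (xi : 'rV[R]_(n + 1)) : 'rV[R]_n := lsubmx xi.
Definition epart (xi : 'rV[R]_(n + 1)) : R := rsubmx xi 0 0.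

Definition coupled_rhs (t : R) (xi : 'rV[R]_(n + 1)) : 'rV[R]_(n + 1) :=
  state (f t (xpart xi) (epart xi)) (g t (xpart xi)).

Definition solution (e0 : R) (x0 : 'rV[R]_n) (b : \bar R)
    (xi : R -> 'rV[R]_(n + 1)) : Prop :=
  filippov_solution coupled_rhs b (state x0 e0) xi.

(* x may rest at 0 whatever the value of eps; w is the velocity of eps. *)
Definition zero_equilibrium : Prop :=
  forall e : R, {ae lebesgue_measure, forall t : R, 0 <= t ->
    exists w : R, filippov_set coupled_rhs t (state 0 e) (state 0 w)}.

(* In the notions below eps(0) = e0 is fixed and x0 ranges over R^n.  They are
   strong notions: they constrain all solutions, including those that are only
   defined on a bounded interval [0, b). *)

Definition lyapunov_stable (e0 : R) : Prop :=
  forall eta : R, 0 < eta -> exists2 delta : R, 0 < delta &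
    forall x0 b xi, `|x0| < delta -> solution e0 x0 b xi ->
      forall t, horizon b t -> `|xpart (xi t)| < eta.

Definition uniformly_bounded (e0 : R) : Prop :=
  forall r : R, exists M : R,
    forall x0 b xi, `|x0| <= r -> solution e0 x0 b xi ->
      forall t, horizon b t -> `|xpart (xi t)| <= M.

(* Equivalently, |x(t)| <= sigma(|x0|) for some class K-infinity sigma. *)
Definition globally_stable (e0 : R) : Prop :=
  lyapunov_stable e0 /\ uniformly_bounded e0.

Definition settling_function (e0 : R) (T0 : 'rV[R]_n -> R) : Prop :=
  (forall x0, 0 <= T0 x0) /\
  forall x0 b xi, solution e0 x0 b xi ->
    forall t, horizon b t -> T0 x0 <= t -> xpart (xi t) = 0.

Definition FTS (e0 : R) : Prop :=
  globally_stable e0 /\ exists T0, settling_function e0 T0.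

Definition FxTS (e0 T : R) : Prop :=
  FTS e0 /\
  exists2 T0, settling_function e0 T0 & forall x0, T0 x0 <= T.

Definition actual_settling_time (xi : R -> 'rV[R]_(n + 1)) : R :=
  inf [set tau | 0 <= tau /\ forall t, tau <= t -> xpart (xi t) = 0].

Definition EFxTS (e0 T : R) : Prop :=
  FxTS e0 T /\
  forall x0 xi, x0 != 0 -> solution e0 x0 +oo%E xi ->
    actual_settling_time xi = T.

(* The relation rel holds between dV/dt and vf(eps(t), x(t)), for almost every
   t, along every solution starting with eps(0) = e0. *)
Definition along_solutions (e0 : R) (rel : R -> R -> Prop)
    (V : 'rV[R]_n -> R) (vf : R -> 'rV[R]_n -> R) : Prop :=
  forall x0 b xi, solution e0 x0 b xi ->
    {ae lebesgue_measure, forall t : R, 0 < t -> (t%:E < b)%E ->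
       rel (derive1 (fun s : R => V (xpart (xi s))) t)
           (vf (epart (xi t)) (xpart (xi t)))}.

End CoupledSystem.

Section LyapunovFunction.
Variables (R : realType) (n : nat) (V : 'rV[R]_n -> R).

Definition positive_definite : Prop :=
  V 0 = 0 /\ forall x, x != 0 -> 0 < V x.

Definition radially_unbounded : Prop :=
  forall M : R, exists r : R, forall x, r < `|x| -> M < V x.

Definition continuously_differentiable : Prop :=
  (forall x, differentiable V x) /\
  forall v : 'rV[R]_n, continuous (fun x => 'D_v V x).

End LyapunovFunction.

(* Main.v *)
(* Put W := V^alpha.  While V > 0 the hypotheses read W' <= - omega * eps and
   eps' = omega * W, a one-sided version of the rotation
   (W, eps)' = omega * (- eps, W).  Hence W sin (omega t) - eps cos (omega t) is
   nonincreasing up to t = T := pi / (2 omega), where it equals W(T), while its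
   initial value is - eps(0) <= 0: V must vanish by time T, and it stays at 0
   since it is nonincreasing.  In the case of equality with eps(0) = 0 both
   W sin (omega t) - eps cos (omega t) and W cos (omega t) + eps sin (omega t)
   are constant, so W(t) = W(0) cos (omega t), which is positive before T.
   Along Filippov solutions these derivatives exist only almost everywhere;
   V itself is absolutely continuous, but W only away from the zeros of V. *)

Require Import Defs.
From HB Require Import structures.
From mathcomp Require Import all_boot all_order all_algebra.
From mathcomp Require Import all_classical all_reals all_analysis.
From mathcomp Require Import ring lra.

Set Implicit Arguments.
Unset Strict Implicit.
Unset Printing Implicit Defensive.

Import Order.TTheory GRing.Theory Num.Theory.
Import numFieldNormedType.Exports.

Local Open Scope classical_set_scope.
Local Open Scope ring_scope.

(** * Absolutely continuous functions *)

(** Induction along a segment, run at the supremum of the points where [P] holds. The step only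
    carries [P] across a point [x], from [s <= x] to [s' >= x], which is what a local estimate
    around [x] can provide. *)
Lemma segment_ind (R : realType) (P : R -> Prop) (c d : R) :
  c <= d -> P c ->
  (forall x, c <= x <= d -> exists2 r, 0 < r & forall s s',
     c <= s -> s' <= d -> x - r < s -> s <= x -> x <= s' -> s' < x + r ->
     P s -> P s') ->
  P d.
Proof.
move=> cd Pc step.
pose S := [set t | c <= t <= d /\ P t].
have Sc : S c by split=> //; rewrite lexx cd.
have ubS : ubound S d by move=> t [/andP[]].
have supS : has_sup S by split; [exists c | exists d].
have cx : c <= sup S by exact: (ub_le_sup supS.2).
have xd : sup S <= d by apply: ge_sup => //; exists c.
have [r r0 stepr] := step _ (introT andP (conj cx xd)).
have [s [/andP[cs sd] Ps] rs] := sup_adherent r0 supS.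
have sx : s <= sup S by apply: (ub_le_sup supS.2); split; rewrite ?cs.
have [dr|rd] := leP d (sup S + r / 2).
  by apply: (stepr s d) => //; lra.
have : S (sup S + r / 2).
  by split; [lra | apply: (stepr s) => //; lra].
by move=> /(ub_le_sup supS.2); lra.
Qed.

(** The formula of [abs_continuous] with values in any normed module, so that the same lemmas serve
    the vector path and scalar functions. *)
Definition abs_cont (R : realType) (W : normedModType R) (F : R -> W)
    (c d : R) : Prop :=
  forall eta : R, 0 < eta -> exists2 delta : R, 0 < delta &
    forall (q : nat) (u v : 'I_q -> R),
      (forall i, c <= u i /\ u i <= v i /\ v i <= d) ->
      (forall i j, i != j -> v i <= u j \/ v j <= u i) ->
      \sum_(i < q) (v i - u i) < delta ->
      \sum_(i < q) `|F (v i) - F (u i)| < eta.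

Section AbsCont.
Variable R : realType.
Notation mu := (@lebesgue_measure R).
Implicit Types (W : normedModType R) (F G : R -> R) (c d : R).

(** Sums, products and Lipschitz images all reduce to such a bound on increments. *)
Lemma abs_cont_bound W1 W2 W3 (F : R -> W1) (G : R -> W2) (H : R -> W3)
    (K L c d : R) :
  (forall u v, c <= u -> u <= v -> v <= d ->
     `|H v - H u| <= K * `|F v - F u| + L * `|G v - G u|) ->
  abs_cont F c d -> abs_cont G c d -> abs_cont H c d.
Proof.
move=> HFG acF acG eta eta0.
(* [K] and [L] may have any sign; [M] is positive and dominates both. *)
pose M := 1 + `|K| + `|L|.
have M0 : 0 < M by rewrite /M -addrA ltr_pwDl// addr_ge0.
have e0 : 0 < eta / (2 * M) by rewrite divr_gt0// mulr_gt0.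
have [d1 d10 Fd] := acF _ e0; have [d2 d20 Gd] := acG _ e0.
exists (Num.min d1 d2) => [|q u v uv nov]; first by rewrite lt_min d10.
rewrite lt_min => /andP[/(Fd q u v uv nov) Fs /(Gd q u v uv nov) Gs].
have Hs : \sum_(i < q) `|H (v i) - H (u i)| <=
    M * \sum_(i < q) `|F (v i) - F (u i)| + M * \sum_(i < q) `|G (v i) - G (u i)|.
  rewrite !mulr_sumr -big_split/=; apply: ler_sum => i _.
  have [cu [uvi vd]] := uv i.
  apply: (le_trans (HFG _ _ cu uvi vd)).
  have KM : K <= M by have := ler_norm K; have := normr_ge0 L; rewrite /M; lra.
  have LM : L <= M by have := ler_norm L; have := normr_ge0 K; rewrite /M; lra.
  by apply: lerD; apply: ler_wpM2r.
apply: (le_lt_trans Hs); rewrite -mulrDr mulrC -ltr_pdivlMr//.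
have -> : eta / M = eta / (2 * M) + eta / (2 * M).
  by field; rewrite gt_eqF.
exact: ltrD.
Qed.

Lemma abs_cont_lipschitz W1 W2 (F : R -> W1) (G : R -> W2) (L c d : R) :
  (forall u v, c <= u -> u <= v -> v <= d ->
     `|G v - G u| <= L * `|F v - F u|) ->
  abs_cont F c d -> abs_cont G c d.
Proof.
move=> GF acF; apply: (@abs_cont_bound _ _ _ F F G L 0) => // u v cu uv vd.
by rewrite mul0r addr0 GF.
Qed.

Lemma abs_contD F G c d : abs_cont F c d -> abs_cont G c d ->
  abs_cont (F \+ G) c d.
Proof.
apply: (@abs_cont_bound R^o R^o R^o _ _ _ 1 1) => u v _ _ _ /=.
by rewrite !mul1r opprD addrACA ler_normD.
Qed.

Lemma abs_contN F c d : abs_cont F c d -> abs_cont (\- F) c d.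
Proof.
apply: (@abs_cont_lipschitz R^o R^o _ _ 1) => u v _ _ _ /=.
by rewrite mul1r -opprD normrN.
Qed.

Lemma abs_contM F G (K c d : R) :
  (forall t, c <= t <= d -> `|F t| <= K) ->
  (forall t, c <= t <= d -> `|G t| <= K) ->
  abs_cont F c d -> abs_cont G c d -> abs_cont (F \* G) c d.
Proof.
move=> FK GK; apply: (@abs_cont_bound R^o R^o R^o _ _ _ K K) => u v cu uv vd /=.
have -> : F v * G v - F u * G u = G v * (F v - F u) + F u * (G v - G u) by ring.
apply: (le_trans (ler_normD _ _)); rewrite !normrM.
by apply: lerD; apply: ler_wpM2r => //; [apply: GK | apply: FK]; lra.
Qed.

Lemma abs_cont_sub W (F : R -> W) c d c' d' : c <= c' -> d' <= d ->
  abs_cont F c d -> abs_cont F c' d'.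
Proof.
move=> cc dd acF eta /acF[delta delta0 Fd]; exists delta => // q u v uv.
by apply: Fd => i; have [? [? ?]] := uv i; lra.
Qed.

Lemma abs_cont_dist W (F : R -> W) c d : abs_cont F c d ->
  forall eta : R, 0 < eta -> exists2 delta : R, 0 < delta &
    forall u v, c <= u <= d -> c <= v <= d -> `|v - u| < delta ->
      `|F v - F u| < eta.
Proof.
move=> acF eta /acF[delta delta0 Fd]; exists delta => //.
have le_case u v : c <= u <= d -> c <= v <= d -> u <= v -> `|v - u| < delta ->
    `|F v - F u| < eta.
  move=> cu cv uv vu; have := Fd 1%N (fun=> u) (fun=> v).
  rewrite !big_ord1; apply => //; [by move=> _; lra | | ].
  - by move=> i j; rewrite !ord1.
  - by rewrite ger0_norm in vu; lra.
move=> u v cu cv; have [uv|/ltW vu] := leP u v; first exact: le_case.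
by rewrite distrC (distrC (F v)); apply: le_case.
Qed.

Lemma abs_cont_continuous F c d : abs_cont F c d ->
  {within `[c, d], continuous F}.
Proof.
move=> acF; apply/subspace_continuousP => x /=; rewrite in_itv/= => xcd.
apply/cvgrPdist_lt => eta /(abs_cont_dist acF)[delta delta0 Fd].
rewrite near_withinE; near=> t; rewrite /= in_itv/= => tcd.
by apply: Fd => //; near: t.
Unshelve. all: by end_near. Qed.

Lemma abs_cont_bounded F c d : abs_cont F c d ->
  exists K, forall t, c <= t <= d -> `|F t| <= K.
Proof.
move=> acF; have [cd|dc] := leP c d; last by exists 0 => t; lra.
have cF := abs_cont_continuous acF.
have [x _ xmax] := EVT_max cd cF; have [y _ ymin] := EVT_min cd cF.
exists (Num.max (F x) (- F y)) => t tcd; rewrite ler_norml.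
have := xmax t; have := ymin t; rewrite !in_itv/= => /(_ tcd) Fy /(_ tcd) Fx.
by rewrite le_max Fx andbT lerNl le_max lerN2 Fy orbT.
Qed.

End AbsCont.

(** * Monotonicity from the sign of the derivative almost everywhere *)

Section Monotone.
Variable R : realType.
Notation mu := (@lebesgue_measure R).
Implicit Types (F : R -> R) (c d : R).

(** Outer regularity, applied to the exceptional null set enlarged by [c] and [d]. With both
    endpoints in [U], a point of the segment outside [U] is interior. *)
Lemma ae_open_cover (P : R -> Prop) (c d delta : R) : 0 < delta ->
  {ae mu, forall t, P t} ->
  exists U, [/\ open U, U c, U d, (mu U < delta%:E)%E &
    forall t, ~ U t -> P t].
Proof.
move=> delta0 [N [mN N0 NP]].
pose D := N `|` [set c] `|` [set d].
have nD : mu.-negligible D.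
  have n1 x : mu.-negligible [set x].
    by apply/negligibleP => //; exact: lebesgue_measure_set1.
  by apply: negligibleU => //; apply: negligibleU => //; exact/negligibleP.
have mD : measurable D by apply: measurableU => //; apply: measurableU.
have D0 : mu D = 0%E by exact: measure_negligible.
have Doo : (mu D < +oo)%E by rewrite D0.
have [U [oU DU muU]] := lebesgue_regularity_outer mD Doo delta0.
have mU : measurable U by exact: measurable_realfun.open_measurable.
exists U; split => //; first by apply: DU; left; right.
- by apply: DU; right.
- by rewrite -(setDUK DU) setUC measureU0//; exact: measurableD.
- by move=> t nUt; apply: contrapT => nP; apply: nUt; apply: DU; left; left; apply: NP.
Qed.

(** Near [x] the difference quotients are at most [eps] on either side; adding the two estimates
    covers every short interval straddling [x]. *)
Lemma derive1_le0_slope F (x eps : R) : 0 < eps -> derivable F x 1 ->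
  derive1 F x <= 0 -> exists2 r, 0 < r & forall s s',
    x - r < s -> s <= x -> x <= s' -> s' < x + r ->
    F s' - F s <= eps * (s' - s).
Proof.
move=> eps0 dF F0.
have /cvgrPdist_lt/(_ _ eps0) : h^-1 *: (F (h + x) - F x) @[h --> 0^'] --> derive1 F x.
  move: dF; rewrite /derivable /derive1.
  by under eq_fun do rewrite [_%:A]mulr1.
rewrite near_withinE => /nbhs_ballP[r /= r0 Fr].
have slope h : `|h| < r -> h != 0 -> h^-1 * (F (h + x) - F x) <= eps.
  move=> hr h0; have /= := Fr h; rewrite /ball/= sub0r normrN => /(_ hr h0).
  by rewrite ltr_norml => /andP[]; rewrite /GRing.scale/=; lra.
exists r => // s s' rs sx xs' s'r.
have right : F s' - F x <= eps * (s' - x).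
  have [->|ne] := eqVneq s' x; first by rewrite !subrr mulr0.
  have xs : 0 < s' - x by rewrite subr_gt0 lt_neqAle eq_sym ne.
  have := slope (s' - x); rewrite subrK gtr0_norm// gt_eqF//.
  by rewrite mulrC ler_pdivrMr//; apply; lra.
have left : F x - F s <= eps * (x - s).
  have [->|ne] := eqVneq s x; first by rewrite !subrr mulr0.
  have xs : 0 < x - s by rewrite subr_gt0 lt_neqAle ne.
  have := slope (s - x); rewrite subrK -opprB normrN gtr0_norm// oppr_eq0 gt_eqF//.
  by rewrite invrN mulNr -mulrN opprB mulrC ler_pdivrMr//; apply; lra.
lra.
Qed.

(* The part of the increase of F over [c, t] not controlled by the slope eps
   is carried by finitely many intervals inside U. *)
Definition covered_growth F (U : set R) (c eps t : R) (l : seq (R * R)) :=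
  [/\ forall p, p \in l -> c <= p.1 /\ p.1 <= p.2 /\ p.2 <= t,
      pairwise (fun p q : R * R => q.2 <= p.1) l,
      ((\sum_(p <- l) (p.2 - p.1))%:E <= mu (U `&` `[c, t[))%E &
      F t - F c <= eps * (t - c) + \sum_(p <- l) `|F p.2 - F p.1|].

(** Off a small open set [U] the local slope is at most [eps]; the intervals used inside [U] have
    total length below [delta], so by absolute continuity they contribute less than [eps]. Induction
    along the segment glues both kinds of points. *)
Lemma abs_cont_ae_nonincr F c d : c <= d -> abs_cont F c d ->
  {ae mu, forall t, c < t -> t < d -> derivable F t 1 /\ derive1 F t <= 0} ->
  F d <= F c.
Proof.
move=> cd acF dF.
suff main eps : 0 < eps -> F d - F c <= eps * (d - c) + eps.
  rewrite -subr_le0; apply/ler_addgt0Pr => e e0; rewrite add0r.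
  have dc1 : 0 < d - c + 1 by lra.
  have := main (e / (d - c + 1)); rewrite divr_gt0// => /(_ isT).
  have -> : e / (d - c + 1) * (d - c) + e / (d - c + 1) = e.
    by field; rewrite gt_eqF.
  by [].
move=> eps0.
have [delta delta0 Fdelta] := acF _ eps0.
have [U [oU Uc Ud muU UP]] := ae_open_cover c d delta0 dF.
have mU : measurable U by exact: measurable_realfun.open_measurable.
(* The list reaching [d] has total length at most the measure of [U], hence below [delta], and the
   choice of [delta] applies to it. *)
suff [l [lcd lsort lmu lF]] : exists l, covered_growth F U c eps d l.
  apply: (le_trans lF); rewrite lerD2l.
  rewrite (big_nth (0, 0)) big_mkord; apply/ltW/Fdelta.
  - by move=> i; apply: lcd; rewrite mem_nth.
  - move=> i j; move/(pairwiseP (0, 0)): lsort => lsort.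
    rewrite -val_eqE neq_ltn => /orP[ij|ji]; [right|left].
    + by apply: lsort => //; exact: ltn_ord.
    + by apply: lsort => //; exact: ltn_ord.
  - rewrite -lte_fin; apply: le_lt_trans muU.
    rewrite -(big_mkord xpredT (fun i => (nth (0, 0) l i).2 - (nth (0, 0) l i).1)).
    rewrite -(big_nth (0, 0) xpredT (fun p => p.2 - p.1)).
    apply: (le_trans lmu); apply: le_measure; rewrite ?inE//.
    by apply: measurableI.
apply: (@segment_ind R (fun t => exists l, covered_growth F U c eps t l) c d) => //.
  exists [::]; split => //; first by rewrite big_nil.
  by rewrite !big_nil !subrr mulr0 addr0.
move=> x /andP[cx xd].
have [Ux|nUx] := pselect (U x).
  have /nbhs_ballP[r /= r0 xrU] : nbhs x U by exact: open_nbhs_nbhs.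
  exists r => // s s' cs s'd rs sx xs' s'r [l [lcs lsort lmu lF]].
  have ss' : s <= s' by lra.
  have ssU : `[s, s'[ `<=` U.
    move=> y /=; rewrite in_itv/= => /andP[sy ys]; apply: xrU.
    by rewrite /ball/= ltr_norml; lra.
  (* The new interval goes to the head, so the list runs from right to left. Half-open intervals
     make the measures add up exactly. *)
  exists ((s, s') :: l); split.
  - move=> p; rewrite inE => /orP[/eqP->//|/lcs]; last by lra.
  - rewrite /= lsort andbT; apply/allP => p /lcs /=; lra.
  - have -> : U `&` `[c, s'[ = (U `&` `[c, s[) `|` `[s, s'[.
      apply/seteqP; split => y /=; rewrite !in_itv/=.
        by case=> Uy /andP[cy ys]; have [sy|ys'] := leP s y; [right|left]; rewrite ?ys ?cy.
      case=> [[Uy /andP[cy ys]]|/andP[sy ys]]; split => //.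
      + lra.
      + by apply: ssU; rewrite /= in_itv/= sy.
      + lra.
    rewrite measureU ?big_cons ?EFinD//=; first last.
    + rewrite -subset0 => y /= []; rewrite !in_itv/= => -[_ ?] ?; lra.
    + by apply: measurableI.
    rewrite addeC; apply: leeD => //.
    rewrite lebesgue_measure_itv/= lte_fin.
    by case: ltP => // s's; rewrite lee_fin; lra.
  - rewrite big_cons/=; have := ler_norm (F s' - F s).
    have : 0 <= eps * (s' - s) by rewrite mulr_ge0//; lra.
    move: lF; rewrite !mulrBr; lra.
(* Outside [U] the point is neither [c] nor [d], so the derivative is available. *)
have [cx' xd'] : c < x /\ x < d.
  by split; rewrite lt_neqAle ?cx ?xd andbT; apply/eqP => E; apply: nUx; rewrite -?E// E.
have [dFx Fx0] := UP x nUx cx' xd'.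
have [r r0 Fr] := derive1_le0_slope eps0 dFx Fx0.
exists r => // s s' cs s'd rs sx xs' s'r [l [lcs lsort lmu lF]].
exists l; split => //.
- by move=> p /lcs; lra.
- apply: (le_trans lmu); apply: le_measure; rewrite ?inE.
  + exact: measurableI.
  + exact: measurableI.
  + by apply: setIS => y /=; rewrite !in_itv/= => /andP[-> ys]; lra.
- have := Fr _ _ rs sx xs' s'r; move: lF; rewrite !mulrBr; lra.
Qed.

End Monotone.

(** * The scalar comparison system *)

Section Rotation.
Variable R : realType.
Notation mu := (@lebesgue_measure R).

Lemma ae_imply (P Q : R -> Prop) : (forall t, P t -> Q t) ->
  {ae mu, forall t, P t} -> {ae mu, forall t, Q t}.
Proof. by move=> PQ; apply: filterS => //; exact: (ae_filter_ringOfSetsType mu). Qed.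

Lemma ae_imply2 (P Q S : R -> Prop) : (forall t, P t -> Q t -> S t) ->
  {ae mu, forall t, P t} -> {ae mu, forall t, Q t} -> {ae mu, forall t, S t}.
Proof. by move=> PQS; apply: filterS2 => //; exact: (ae_filter_ringOfSetsType mu). Qed.

Lemma lipschitz_segment (f df : R -> R) (L a b : R) : a <= b ->
  (forall x, a <= x <= b -> is_derive x 1 f (df x) /\ `|df x| <= L) ->
  `|f b - f a| <= L * `|b - a|.
Proof.
move=> ab dfL.
have fab : {within `[a, b], continuous f}.
  apply: derivable_within_continuous => x; rewrite in_itv/= => /dfL[].
  by case.
have dfab x : x \in `]a, b[%R -> is_derive x 1 f (df x).
  by rewrite in_itv/= => /andP[ax xb]; apply: (dfL x _).1; rewrite !ltW.
have [z] := MVT_segment ab dfab fab; rewrite in_itv/= => zab fE.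
rewrite fE normrM ler_wpM2r//.
by have [] := dfL _ zab.
Qed.

Lemma abs_cont_id (c d : R) : abs_cont (fun t : R => t : R^o) c d.
Proof.
move=> eta eta0; exists eta => // q u v uv _.
rewrite (eq_bigr (fun i => `|v i - u i|)) => [|i _]; first by [].
by have [_ [ui _]] := uv i; rewrite ger0_norm// subr_ge0.
Qed.

(** The phase [p] lets this cover cosines too, by a shift of [pi / 2]. *)
Lemma abs_cont_sin (omega p c d : R) :
  abs_cont (fun t => sin (omega * t + p)) c d.
Proof.
apply: (@abs_cont_lipschitz R R^o R^o (fun t : R => t) _ `|omega|); last first.
  exact: abs_cont_id.
move=> u v _ uv _.
apply: (@lipschitz_segment (fun t => sin (omega * t + p))
  (fun t => omega * cos (omega * t + p))) => // x _.
split; last by rewrite normrM ler_piMr// cos_max.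
by apply: is_derive_eq; rewrite /GRing.scale/=; ring.
Qed.

(** The power [alpha < 1] has unbounded slope near 0; above [m > 0] it is Lipschitz, with its slope
    at [m] as constant. *)
Lemma abs_cont_powR (v : R -> R) (alpha m c d : R) :
  0 < alpha < 1 -> 0 < m -> (forall t, c <= t <= d -> m <= v t) ->
  abs_cont v c d -> abs_cont (fun t => v t `^ alpha) c d.
Proof.
move=> /andP[a0 a1] m0 mv.
apply: (@abs_cont_lipschitz R R^o R^o _ _ (alpha * m `^ (alpha - 1))).
move=> s t cs st td.
have pow x y : m <= x -> x <= y ->
    `|y `^ alpha - x `^ alpha| <= alpha * m `^ (alpha - 1) * `|y - x|.
  move=> mx xy.
  apply: (@lipschitz_segment (fun z => z `^ alpha)
    (fun z => alpha * z `^ (alpha - 1))) => // z /andP[xz zy].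
  have z0 : 0 < z by lra.
  split; first exact: is_derive1_powR.
  rewrite ger0_norm ?mulr_ge0 ?powR_ge0 ?(ltW a0)// ler_wpM2l ?(ltW a0)//.
  rewrite -[alpha - 1]opprB !powRN lef_pV2 ?posrE ?powR_gt0//.
  by apply: ge0_ler_powR; rewrite ?nnegrE; lra.
have ms : m <= v s by apply: mv; lra.
have mt : m <= v t by apply: mv; lra.
have [/pow|/ltW/pow] := leP (v s) (v t); first exact.
by rewrite distrC (distrC (v s)); apply.
Qed.

(** * Decay of [v] driven by the auxiliary variable [e] *)

Section Comparison.
Variables (omega alpha : R) (v e : R -> R) (b : \bar R).
Hypothesis omega_gt0 : 0 < omega.
Hypothesis alpha01 : 0 < alpha < 1.
Hypothesis v_ge0 : forall t, 0 <= v t.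
Hypothesis acv : forall c, horizon b c -> abs_cont v 0 c.
Hypothesis ace : forall c, horizon b c -> abs_cont e 0 c.
Hypothesis e0_ge0 : 0 <= e 0.
Hypothesis dve : {ae mu, forall t, 0 < t -> (t%:E < b)%E ->
  [/\ derivable v t 1, is_derive t 1 e (omega * v t `^ alpha) &
      derive1 v t <= - (omega / alpha) * e t * v t `^ (1 - alpha)]}.

(* With (W, e) = (r cos phi, r sin phi), W := v^alpha, this is
   r sin (omega * t + p - phi): it is constant when phi rotates at speed omega. *)
Definition rotated (p t : R) :=
  v t `^ alpha * sin (omega * t + p) - e t * cos (omega * t + p).

Lemma horizon_le s t : 0 <= s -> s <= t -> horizon b t -> horizon b s.
Proof. by move=> s0 st [_ tb]; split => //; apply: le_lt_trans tb; rewrite lee_fin. Qed.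

Lemma ae_horizon (P : R -> Prop) s t : 0 <= s -> horizon b t ->
  {ae mu, forall u, 0 < u -> (u%:E < b)%E -> P u} ->
  {ae mu, forall u, s < u -> u < t -> P u}.
Proof.
move=> s0 [_ tb]; apply: ae_imply => u Pu su ut; apply: Pu; first lra.
by apply: lt_trans tb; rewrite lte_fin.
Qed.

Lemma e_ge0 t : horizon b t -> 0 <= e t.
Proof.
move=> bt; apply: (le_trans e0_ge0); rewrite -lerN2.
have t0 : 0 <= t by case: bt.
apply: (abs_cont_ae_nonincr (F := \- e) t0); first exact/abs_contN/ace.
apply: ae_imply _ (ae_horizon (lexx 0) bt dve) => u du u0 ut.
have [_ deu _] := du u0 ut.
have dNe : is_derive u 1 (\- e) (- (omega * v u `^ alpha)) by exact: is_deriveN.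
split; first by case: dNe.
by rewrite derive1E derive_val oppr_le0 mulr_ge0 ?powR_ge0// ltW.
Qed.

Lemma v_nonincr s t : 0 <= s -> s <= t -> horizon b t -> v t <= v s.
Proof.
move=> s0 st bt; apply: abs_cont_ae_nonincr => //.
  exact: abs_cont_sub s0 (lexx t) (acv bt).
apply: ae_imply _ (ae_horizon s0 bt dve) => u du su ut.
have [dv _ dvle] := du su ut; split => //; apply: (le_trans dvle).
rewrite !mulNr oppr_le0 mulr_ge0 ?powR_ge0// mulr_ge0//.
  by case/andP: alpha01 => a0 _; rewrite divr_ge0 ?ltW.
by apply: e_ge0; apply: horizon_le bt; lra.
Qed.

(** As [v] is nonincreasing, [v t] bounds it below on all of [[0, t]], which keeps the power away
    from its singularity. *)
Lemma rotated_abs_cont p t : horizon b t -> 0 < v t ->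
  abs_cont (rotated p) 0 t.
Proof.
move=> bt vt.
have acW : abs_cont (fun s => v s `^ alpha) 0 t.
  apply: (@abs_cont_powR _ _ (v t)) => // [s /andP[s0 st]|]; last exact: acv.
  exact: v_nonincr.
have acM (f g : R -> R) : abs_cont f 0 t -> abs_cont g 0 t ->
    abs_cont (f \* g) 0 t.
  move=> acf acg; have [K fK] := abs_cont_bounded acf.
  have [L gL] := abs_cont_bounded acg.
  by apply: (@abs_contM _ _ _ (Num.max K L)) => // s st; rewrite le_max ?fK ?gL ?orbT.
apply: abs_contD; first exact/acM/abs_cont_sin.
apply/abs_contN/acM; first exact: ace.
have -> : (fun s => cos (omega * s + p)) = (fun s => sin (omega * s + (p + pi / 2))).
  by apply/funext => s; rewrite addrA sinDpihalf.
exact: abs_cont_sin.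
Qed.

(** The cosine terms cancel by the equation for [e]; the sine is multiplied by the defect in the
    equation W' = - omega * eps. *)
Lemma rotated_derive p t dv : 0 < v t -> is_derive t 1 v dv ->
  is_derive t 1 e (omega * v t `^ alpha) ->
  is_derive t 1 (rotated p)
    (sin (omega * t + p) * (alpha * v t `^ (alpha - 1) * dv + omega * e t)).
Proof.
move=> vt dvt det.
have dW : is_derive t 1 (fun s => v s `^ alpha) (alpha * v t `^ (alpha - 1) * dv).
  exact: (is_derive1_comp (is_derive1_powR alpha vt) dvt).
by apply: is_derive_eq; rewrite /GRing.scale/=; ring.
Qed.

(* The extremal decay rate of V amounts to (V^alpha)' = - omega * eps. *)
Lemma rate_cancel x y : 0 < x ->
  alpha * x `^ (alpha - 1) * (- (omega / alpha) * y * x `^ (1 - alpha)) =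
  - (omega * y).
Proof.
move=> x0; rewrite -[alpha - 1]opprB powRN.
have alpha_neq0 : alpha != 0 by case/andP: alpha01 => a0 _; rewrite gt_eqF.
have pow_neq0 : x `^ (1 - alpha) != 0 by rewrite gt_eqF// powR_gt0.
by field; rewrite alpha_neq0 pow_neq0.
Qed.

Lemma v_reaches0 t : horizon b t -> pi / (2 * omega) <= t -> v t = 0.
Proof.
move=> bt Tt; set T := pi / (2 * omega) in Tt *.
have T0 : 0 < T by rewrite divr_gt0 ?pi_gt0// mulr_gt0.
have bT : horizon b T by apply: horizon_le bt; lra.
apply/eqP; rewrite eq_le v_ge0 andbT leNgt; apply/negP => vt.
have vT : 0 < v T by apply: (lt_le_trans vt); apply: v_nonincr => //; lra.
have wT : omega * T + 0 = pi / 2 by rewrite /T; field; rewrite gt_eqF.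
(* At [T] the phase is [pi / 2] and [rotated] is the positive power of [v T]; at 0 it is
   [- e 0 <= 0]. *)
suff : rotated 0 T <= rotated 0 0.
  rewrite /rotated wT mulr0 addr0 sin_pihalf cos_pihalf sin0 cos0.
  by apply/negP; rewrite -ltNge; move: (powR_gt0 alpha vT) e0_ge0; lra.
apply: (abs_cont_ae_nonincr (ltW T0)); first exact: rotated_abs_cont.
apply: ae_imply _ (ae_horizon (lexx 0) bT dve) => u du u0 uT.
have [dv deu dvle] := du u0 uT.
have vu : 0 < v u by apply: (lt_le_trans vT); apply: v_nonincr => //; lra.
have [] := rotated_derive 0 vu (DeriveDef dv erefl) deu; rewrite derive1E => drot ->.
(* Up to [T] the phase stays in the first quadrant, where the sine is nonnegative; the other factor
   is nonpositive by the decay inequality. *)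
split => //; apply: mulr_ge0_le0.
  apply: sin_ge0_pi; rewrite addr0 mulr_ge0 ?(ltW u0) ?(ltW omega_gt0)//=.
  have : omega * u <= omega * T by rewrite ler_pM2l// ltW.
  have := @pi_gt0 R; lra.
rewrite -derive1E -lerBrDr sub0r -(rate_cancel _ vu) ler_wpM2l//.
by rewrite mulr_ge0 ?powR_ge0//; case/andP: alpha01 => /ltW.
Qed.

(** * Exact solution in the case of equality *)

Section Equality.
Hypothesis e00 : e 0 = 0.
Hypothesis v0_gt0 : 0 < v 0.
Hypothesis dv_eq : {ae mu, forall t, 0 < t -> (t%:E < b)%E ->
  derive1 v t = - (omega / alpha) * e t * v t `^ (1 - alpha)}.

(** The derivative vanishes almost everywhere, so [rotated p] and its opposite are both
    nonincreasing. *)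
Lemma rotated_cst p t : horizon b t -> 0 < v t -> rotated p t = rotated p 0.
Proof.
move=> bt vt; have t0 : 0 <= t by case: bt.
have drot : {ae mu, forall u, 0 < u -> u < t -> is_derive u 1 (rotated p) 0}.
  apply: ae_imply2 _ (ae_horizon (lexx 0) bt dve) (ae_horizon (lexx 0) bt dv_eq).
  move=> u du dvu u0 ut; have [dv deu _] := du u0 ut.
  have vu : 0 < v u by apply: (lt_le_trans vt); apply: v_nonincr => //; lra.
  have := rotated_derive p vu (DeriveDef dv erefl) deu.
  by rewrite -derive1E dvu// rate_cancel// addNr mulr0.
have acr := rotated_abs_cont p bt vt.
apply/eqP; rewrite eq_le; apply/andP; split.
  apply: (abs_cont_ae_nonincr t0) => //; apply: ae_imply _ drot => u du u0 ut.
  by have [dr dr0] := du u0 ut; rewrite derive1E dr0.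
rewrite -lerN2; apply: (abs_cont_ae_nonincr (F := \- rotated p) t0).
  exact: abs_contN.
apply: ae_imply _ drot => u du u0 ut; have dr := du u0 ut.
have [drN drN0] : is_derive u 1 (\- rotated p) (- 0) by exact: is_deriveN.
by rewrite derive1E drN0 oppr0.
Qed.

(** The phases 0 and [pi / 2] give two conserved quantities, a linear system that the inverse
    rotation solves. *)
Lemma v_cos t : horizon b t -> 0 < v t ->
  v t `^ alpha = v 0 `^ alpha * cos (omega * t).
Proof.
move=> bt vt; have := rotated_cst 0 bt vt; have := rotated_cst (pi / 2) bt vt.
rewrite /rotated e00 !mulr0 !add0r !addr0 !sinDpihalf !cosDpihalf sin0.
rewrite sin_pihalf !mul0r !subr0 mulr1 mulr0 => rc rs.
have := cos2Dsin2 (omega * t).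
set C := cos _ in rc rs *; set S := sin _ in rc rs * => CS.
rewrite -rc; transitivity (v t `^ alpha * (C ^+ 2 + S ^+ 2)); first by rewrite CS mulr1.
by rewrite mulrDr !expr2 (mulrA _ S) (_ : v t `^ alpha * S = e t * C); [ring | lra].
Qed.

(** The cosine formula holds only while [v] is positive, so it cannot be evaluated at a zero [t].
    But on its way to 0 a continuous [v] would take a small positive value [y] at some [s <= t],
    where the formula forces its power to be at least [m]. *)
Lemma v_gt0_before t : horizon b t -> t < pi / (2 * omega) -> 0 < v t.
Proof.
move=> bt tT; rewrite lt_neqAle v_ge0 andbT eq_sym; apply/eqP => vt.
have t0 : 0 <= t by case: bt.
have /andP[a0 a1] := alpha01.
have wt s : 0 <= s -> s <= t -> 0 <= omega * s < pi / 2.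
  move=> s0 st; rewrite mulr_ge0 ?(ltW omega_gt0)//=.
  have -> : pi / 2 = omega * (pi / (2 * omega)) by field; rewrite gt_eqF.
  by rewrite ltr_pM2l//; lra.
pose m := v 0 `^ alpha * cos (omega * t).
have m0 : 0 < m.
  rewrite mulr_gt0 ?powR_gt0//; apply: cos_gt0_pihalf.
  by have := wt t t0 (lexx t); have := @pi_gt0 R; lra.
(* Halving the minimum puts [y] strictly below [v 0], for the intermediate value theorem, and below
   the [1 / alpha] power of [m], for the contradiction. *)
pose y := Num.min (v 0) (m `^ (alpha^-1)) / 2.
have my : 0 < Num.min (v 0) (m `^ (alpha^-1)) by rewrite lt_min v0_gt0 powR_gt0.
have y0 : 0 < y by rewrite divr_gt0.
have yv : y < v 0.
  have : Num.min (v 0) (m `^ (alpha^-1)) <= v 0 by rewrite ge_min lexx.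
  rewrite /y; lra.
have ym : y < m `^ alpha^-1.
  have : Num.min (v 0) (m `^ (alpha^-1)) <= m `^ alpha^-1 by rewrite ge_min lexx orbT.
  rewrite /y; lra.
have [|s] := @IVT _ v 0 t y t0 (abs_cont_continuous (acv bt)).
  by rewrite vt minC maxC minEle maxEle v_ge0; lra.
rewrite in_itv/= => /andP[s0 st] vs.
have : v s `^ alpha = v 0 `^ alpha * cos (omega * s).
  by apply: v_cos; [apply: horizon_le bt | rewrite vs].
have : y `^ alpha < m.
  have -> : m = (m `^ alpha^-1) `^ alpha.
    by rewrite -powRrM mulVf ?gt_eqF// powRr1// ltW.
  by apply: gt0_ltr_powR; rewrite ?nnegrE ?powR_ge0 ?(ltW y0).
rewrite vs => + yE; rewrite yE ltNge => /negP; apply.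
rewrite ler_pM2l ?powR_gt0//.
have := wt s s0 st; have := wt t t0 (lexx t); have := @pi_gt0 R => pi0 wt1 wt2.
have [->//|st'] := eqVneq s t.
have : omega * s < omega * t by rewrite ltr_pM2l// lt_neqAle st'.
by rewrite -ltr_cos ?in_itv/=; [exact: ltW | lra | lra].
Qed.

End Equality.

End Comparison.

End Rotation.

(** * Lyapunov functions *)

Lemma mx_norm_entry (R : realType) (m n : nat) (A : 'M[R]_(m, n)) i j :
  `|A i j| <= `|A|.
Proof.
by rewrite [leRHS]/Num.Def.normr/= mx_normrE; exact: (le_bigmax _ _ (i, j)).
Qed.

Section LyapunovFacts.
Variables (R : realType) (n : nat) (V : 'rV[R]_n -> R).
Hypothesis V_posdef : positive_definite V.
Hypothesis V_radial : radially_unbounded V.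
Hypothesis V_C1 : continuously_differentiable V.

Lemma C1_continuous : continuous V.
Proof. by move=> x; apply: differentiable_continuous; apply: V_C1.1. Qed.

Lemma posdef_ge0 x : 0 <= V x.
Proof. by have [->|/V_posdef.2/ltW//] := eqVneq x 0; rewrite V_posdef.1. Qed.

Lemma posdef_eq0 x : V x = 0 -> x = 0.
Proof.
by move=> Vx; apply/eqP; apply: contraT => /V_posdef.2; rewrite Vx ltxx.
Qed.

Lemma norm_continuous_rV : continuous (fun x : 'rV[R]_n => `|x|).
Proof. exact: norm_continuous. Qed.

Lemma annulus_compact (a r : R) : compact [set x : 'rV[R]_n | a <= `|x| <= r].
Proof.
apply: bounded_closed_compact.
  exists r; split; first exact: num_real.
  by move=> M rM x /= /andP[_ xr]; apply: (le_trans xr); exact: ltW.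
rewrite (_ : [set _ | _] = (fun x : 'rV[R]_n => `|x|) @^-1` `[a, r]); last first.
  by apply/seteqP; split => x /=; rewrite in_itv.
apply: preimage_closed; last exact: itv_closed.
by move=> x _; exact: norm_continuous_rV.
Qed.

Lemma bounded_on_ball (h : 'rV[R]_n -> R) (r : R) : continuous h ->
  exists M, forall x, `|x| <= r -> h x <= M.
Proof.
move=> hc; have [r0|r0] := leP 0 r; last first.
  by exists 0 => x xr; have := normr_ge0 x; lra.
have [||x _ xmax] := @EVT_max_rV R n h [set x | 0 <= `|x| <= r] _ (@annulus_compact 0 r).
- by exists 0; rewrite /= normr0 lexx.
- exact: continuous_subspaceT.
- by exists (h x) => y yr; apply: xmax; rewrite inE/= normr_ge0.
Qed.

(** On the compact annulus between [eta] and [r], [V] has a positive minimum; beyond [r] it exceeds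
    1. *)
Lemma sublevel_near0 (eta : R) : 0 < eta ->
  exists2 m, 0 < m & forall x, V x < m -> `|x| < eta.
Proof.
move=> eta0; have [r rV] := V_radial 1.
pose A := [set x : 'rV[R]_n | eta <= `|x| <= r].
have [[x0 Ax0]|A0] := pselect (A !=set0).
  have [||x xA xmin] := @EVT_min_rV R n V A _ (@annulus_compact eta r).
  - by exists x0.
  - exact: continuous_subspaceT (@C1_continuous).
  - exists (Num.min 1 (V x)).
      rewrite lt_min ltr01 V_posdef.2//; apply/eqP => x00.
      by move: xA; rewrite inE /A/= x00 normr0; lra.
    move=> y; rewrite lt_min => /andP[y1 yx]; rewrite ltNge; apply/negP => ey.
    have [yr|/rV] := leP `|y| r; last lra.
    by have := xmin y; rewrite inE /A/= ey yr leNgt yx => /(_ isT).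
(* Empty annulus: every point of norm at least [eta] lies beyond [r]. *)
exists 1 => // y y1; rewrite ltNge; apply/negP => ey.
have [yr|/rV] := leP `|y| r; last lra.
by apply: A0; exists y; rewrite /A/= ey.
Qed.

(** Mean value theorem along the segment from [x] to [y], which stays in the ball by convexity;
    there the continuous partial derivatives are bounded. *)
Lemma C1_lipschitz_ball (r : R) : exists L, forall x y, `|x| <= r -> `|y| <= r ->
  `|V y - V x| <= L * `|y - x|.
Proof.
pose D i := fun x => `|'D_(delta_mx 0 i) V x|.
have /choice[M DM] i : exists M, forall x, `|x| <= r -> D i x <= M.
  apply: bounded_on_ball.
  by move=> x; exact: cvg_norm (V_C1.2 (delta_mx 0 i) x).
exists (\sum_i M i) => x y xr yr.
pose z (s : R) : 'rV[R]_n := x + s *: (y - x).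
have Vz (s : R) : is_derive s 1 (V \o z : R -> R) ('D_(y - x) V (z s)).
  have qE : (fun h : R => h^-1 *: ((V \o z) (h *: (1 : R) + s) - (V \o z) s)) =
      (fun h : R => h^-1 *: (V (h *: (y - x) + z s) - V (z s))).
    apply/funext => h; rewrite /z /= [h *: (1 : R)]mulr1 scalerDl.
    by rewrite addrCA.
  split; rewrite /derivable /derive qE //.
  exact: diff_derivable (V_C1.1 _).
have zr s : 0 <= s <= 1 -> `|z s| <= r.
  move=> /andP[s0 s1].
  have -> : z s = (1 - s) *: x + s *: y.
    by rewrite /z scalerBr scalerBl scale1r addrCA addrA [RHS]addrC addrA.
  apply: (le_trans (ler_normD _ _)); rewrite !normrZ !ger0_norm ?subr_ge0//.
  have : (1 - s) * `|x| <= (1 - s) * r by rewrite ler_wpM2l// subr_ge0.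
  have : s * `|y| <= s * r by rewrite ler_wpM2l.
  lra.
have DV s : 0 <= s <= 1 -> `|'D_(y - x) V (z s)| <= (\sum_i M i) * `|y - x|.
  move=> /zr zsr; rewrite deriveE; last exact: V_C1.1.
  (* In the standard basis each coordinate of [y - x] is at most its sup norm, so the bounds [M i]
     add up. *)
  rewrite (row_sum_delta (y - x)) linear_sum mulr_suml.
  apply: (le_trans (ler_norm_sum _ _ _)); apply: ler_sum => i _.
  rewrite linearZ normrZ mulrC -deriveE; last exact: V_C1.1.
  apply: ler_pM => //; first exact: DM.
  by rewrite -row_sum_delta; exact: mx_norm_entry.
have /= := @lipschitz_segment R (V \o z) (fun s => 'D_(y - x) V (z s))
  ((\sum_i M i) * `|y - x|) 0 1 ler01.
have -> : z 1 = y by rewrite /z scale1r addrC subrK.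
have -> : z 0 = x by rewrite /z scale0r addr0.
rewrite subr0 normr1 mulr1; apply.
by move=> s s01; split; [exact: Vz | exact: DV].
Qed.

End LyapunovFacts.

(** * Solutions of the coupled system *)

Section Solutions.
Variable R : realType.

Lemma null_set0 (k : nat) : Defs.null_set (set0 : set 'rV[R]_k).
Proof.
move=> eta eta0; exists set0, (fun=> 0), (fun=> 0); split => //.
by rewrite esum_set0 lee_fin ltW.
Qed.

(* The Filippov regularisation leaves the continuous components of the right-hand
   side single-valued. *)
Lemma filippov_set_continuous_entry (k : nat) (h : R -> 'rV[R]_k -> 'rV[R]_k)
    (t : R) (xi w : 'rV[R]_k) (i : 'I_k) :
  {for xi, continuous (fun y => h t y 0 i)} -> filippov_set h t xi w ->
  w 0 i = h t xi 0 i.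
Proof.
move=> hc hw; set a := h t xi 0 i.
apply/eqP; rewrite -subr_eq0 -normr_le0; apply/ler_addgt0Pr => e e0.
rewrite add0r.
have /cvgrPdist_lt/(_ _ e0)/nbhs_ballP[d /= d0 hd] := hc.
(* A closed convex slab containing the values of [h t] on the ball of radius [d]; the Filippov set
   is tested at this radius with the empty null set. *)
pose C := [set y : 'rV[R]_k | a - e <= y 0 i <= a + e].
have closedC : closed C.
  rewrite (_ : C = (fun y : 'rV[R]_k => y 0 i) @^-1` `[a - e, a + e]); last first.
    by apply/seteqP; split => y /=; rewrite in_itv.
  apply: preimage_closed; last exact: itv_closed.
  by move=> y _; exact: coord_continuous.
have := hw d d0 set0 (null_set0 k); rewrite setD0.
have hullC : conv_hull (h t @` ball xi d) `<=` C.
  move=> y; apply; split.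
    move=> y1 y2 l; rewrite !inE /C/= => /andP[y1l y1r] /andP[y2l y2r].
    rewrite /conv/= !mxE.
    have l0 : 0 <= l%:num by [].
    have l1 : 0 <= 1 - l%:num by rewrite subr_ge0.
    have := ler_wpM2l l0 y1l; have := ler_wpM2l l0 y1r.
    have := ler_wpM2l l1 y2l; have := ler_wpM2l l1 y2r.
    rewrite /unstable.onem => h1 h2 h3 h4; apply/andP; split; lra.
  move=> _ [y' /hd + <-]; rewrite /C/= -/a ltr_norml; lra.
move=> /(closureS hullC); rewrite -(closure_id _).1//.
by rewrite /C/= ler_norml; lra.
Qed.

(** * The Lyapunov function and [eps] along Filippov solutions *)

Section Coupled.
Variables (n : nat) (f : R -> 'rV[R]_n -> R -> 'rV[R]_n).
Variables (V : 'rV[R]_n -> R) (omega alpha : R).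
Hypothesis omega_gt0 : 0 < omega.
Hypothesis alpha01 : 0 < alpha < 1.
Hypothesis V_posdef : positive_definite V.
Hypothesis V_radial : radially_unbounded V.
Hypothesis V_C1 : continuously_differentiable V.

Let g := fun (_ : R) (x : 'rV[R]_n) => omega * V x `^ alpha.
Let vf := fun (e : R) (x : 'rV[R]_n) =>
  - (omega / alpha) * e * V x `^ (1 - alpha).

(** Needed for the velocity of [eps] to be single-valued. At 0 the power is not differentiable, and
    continuity is checked directly. *)
Lemma posdef_powR_continuous : continuous (fun x => V x `^ alpha).
Proof.
have /andP[a0 a1] := alpha01.
move=> x; have [x0|x_neq0] := eqVneq x 0; last first.
  have Vx0 : 0 < V x by apply: V_posdef.2.
  apply: (@continuous_comp _ _ _ V (fun y => y `^ alpha)).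
    exact: C1_continuous.
  apply: differentiable_continuous; apply/derivable1_diffP.
  by have [] := is_derive1_powR alpha Vx0.
apply/(@cvgrPdist_lt _ _ _ _ (nbhs_filter x)) => e e0; rewrite x0 V_posdef.1 powR0 ?gt_eqF//.
have e'0 : 0 < e `^ alpha^-1 by exact: powR_gt0.
have /cvgrPdist_lt/(_ _ e'0)/nbhs_ballP[d d0 Vd] := C1_continuous V_C1 (x := 0).
apply/nbhs_ballP; exists d => // y /Vd /=; rewrite V_posdef.1 !sub0r !normrN.
rewrite !ger0_norm ?powR_ge0 ?(posdef_ge0 V_posdef)// => Vy.
have -> : e = (e `^ alpha^-1) `^ alpha.
  by rewrite -powRrM mulVf ?gt_eqF// powRr1// ltW.
by apply: gt0_ltr_powR; rewrite ?nnegrE ?powR_ge0 ?posdef_ge0.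
Qed.

Section OneSolution.
Variables (e0 : R) (x0 : 'rV[R]_n) (b : \bar R) (xi : R -> 'rV[R]_(n + 1)).
Hypothesis sol : solution f g e0 x0 b xi.

Definition vpath t := V (xpart (xi t)).
Definition epath t := epart (xi t).

Lemma vpath0 : vpath 0 = V x0.
Proof. by have [_ xi0 _ _] := sol; rewrite /vpath xi0 /xpart /state row_mxKl. Qed.

Lemma epath0 : epath 0 = e0.
Proof. by have [_ xi0 _ _] := sol; rewrite /epath xi0 /epart /state row_mxKr mxE. Qed.

Lemma epathE : epath = fun t => xi t 0 (rshift n 0).
Proof. by apply/funext => t; rewrite /epath /epart mxE. Qed.

Lemma xi_abs_cont c : horizon b c -> abs_cont xi 0 c.
Proof. by move=> bc; have [_ _ /(_ c bc)] := sol. Qed.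

Lemma norm_xpart (y : 'rV[R]_(n + 1)) : `|xpart y| <= `|y|.
Proof.
rewrite [leLHS]/Num.Def.normr/= mx_normrE.
by apply: bigmax_le => // -[i j] _ /=; rewrite mxE mx_norm_entry.
Qed.

(** On [[0, c]] the path stays in a ball, where [V] is Lipschitz. *)
Lemma vpath_abs_cont c : horizon b c -> abs_cont vpath 0 c.
Proof.
move=> /xi_abs_cont acxi.
have acN : abs_cont (fun t => `|xi t|) 0 c.
  apply: (abs_cont_lipschitz (L := 1)) acxi => u v _ _ _.
  by rewrite mul1r ler_dist_dist.
have [r xir] := abs_cont_bounded acN.
have [L VL] := C1_lipschitz_ball V_C1 r.
apply: (abs_cont_lipschitz (L := `|L|)) acxi => u v cu uv vd.
have xr t : 0 <= t <= c -> `|xpart (xi t)| <= r.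
  by move=> /xir; rewrite normr_id; apply: le_trans; exact: norm_xpart.
apply: le_trans (VL _ _ (xr u _) (xr v _)) _; [lra|lra|].
apply: (@le_trans _ _ (`|L| * `|xpart (xi v) - xpart (xi u)|)).
  by rewrite ler_wpM2r// ler_norm.
by rewrite ler_wpM2l// /xpart -linearB norm_xpart.
Qed.

Lemma epath_abs_cont c : horizon b c -> abs_cont epath 0 c.
Proof.
move=> /xi_abs_cont; apply: (abs_cont_lipschitz (L := 1)) => u v _ _ _.
rewrite epathE mul1r.
by have := mx_norm_entry (xi v - xi u) 0 (rshift n 0); rewrite !mxE.
Qed.

Lemma solution_derive : {ae lebesgue_measure, forall t : R, 0 < t ->
  (t%:E < b)%E ->
  derivable vpath t 1 /\ is_derive t 1 epath (omega * vpath t `^ alpha)}.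
Proof.
have [_ _ _] := sol; apply: ae_imply => t dxi t0 tb.
have [{}dxi Fxi] := dxi t0 tb; split.
  apply/derivable1_diffP.
  have -> : vpath = V \o (lsubmx \o xi) by [].
  apply: differentiable_comp; last exact: V_C1.1.
  apply: differentiable_comp; last exact: differentiable_lsubmx.
  exact/derivable1_diffP.
rewrite epathE; split; first exact: (derivable_mxP _ _ _).1.
(* The target is the last entry of the right-hand side, continuous in the state, so the inclusion
   becomes an equation for [eps]. *)
have -> : omega * vpath t `^ alpha = coupled_rhs f g t (xi t) 0 (rshift n 0).
  by rewrite /coupled_rhs /state row_mxEr mxE.
rewrite -(filippov_set_continuous_entry _ Fxi).
  by rewrite derive1E derive_mx// mxE.
rewrite (_ : (fun y => _) = fun y => omega * V (xpart y) `^ alpha); last first.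
  by apply/funext => y; rewrite /coupled_rhs /state row_mxEr mxE.
have cV : {for xi t, continuous ((fun x => V x `^ alpha) \o lsubmx)}.
  by apply: continuous_comp; [exact: continuous_lsubmx | exact: posdef_powR_continuous].
apply: (continuousM _ cV); exact: cst_continuous.
Qed.

End OneSolution.

Lemma along_vpath (rel : R -> R -> Prop) e0 x0 b xi :
  along_solutions f g e0 rel V vf -> solution f g e0 x0 b xi ->
  {ae lebesgue_measure, forall t : R, 0 < t -> (t%:E < b)%E ->
    [/\ derivable (vpath xi) t 1,
        is_derive t 1 (epath xi) (omega * vpath xi t `^ alpha) &
        rel (derive1 (vpath xi) t)
          (- (omega / alpha) * epath xi t * vpath xi t `^ (1 - alpha))]}.
Proof.
move=> al sol; apply: ae_imply2 (solution_derive sol) (al _ _ _ sol).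
by move=> t ds alt t0 tb; have [? ?] := ds t0 tb; split => //; exact: alt.
Qed.

Lemma xpart_settles e0 x0 b xi t : 0 <= e0 ->
  along_solutions f g e0 (fun dV w => dV <= w) V vf ->
  solution f g e0 x0 b xi -> horizon b t -> pi / (2 * omega) <= t ->
  xpart (xi t) = 0.
Proof.
move=> e00 al sol bt Tt; apply: (posdef_eq0 V_posdef).
apply: (v_reaches0 omega_gt0 alpha01 _ (vpath_abs_cont sol)
  (epath_abs_cont sol) _ (along_vpath al sol) bt Tt).
- by move=> s; exact: posdef_ge0.
- by rewrite (epath0 sol).
Qed.

(** [V] does not increase along solutions, so its sublevel sets give stability and boundedness; the
    comparison system gives a settling time independent of [x0]. *)
Lemma FxTS_of_decay e0 : 0 <= e0 ->
  along_solutions f g e0 (fun dV w => dV <= w) V vf ->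
  FxTS f g e0 (pi / (2 * omega)).
Proof.
move=> e00 al.
have decr x0 b xi t : solution f g e0 x0 b xi -> horizon b t ->
    V (xpart (xi t)) <= V x0.
  move=> sol bt; rewrite -(vpath0 sol).
  apply: (v_nonincr omega_gt0 alpha01 (vpath_abs_cont sol)
    (epath_abs_cont sol) _ (along_vpath al sol)) => //.
  - by rewrite (epath0 sol).
  - by case: bt.
have settle : settling_function f g e0 (fun=> pi / (2 * omega)).
  split; first by move=> _; rewrite divr_ge0 ?pi_ge0// mulr_ge0// ltW.
  by move=> x0 b xi sol t bt Tt; exact: (xpart_settles e00 al sol bt Tt).
split; last by exists (fun=> pi / (2 * omega)).
split; last by exists (fun=> pi / (2 * omega)).
split.
  move=> eta eta0; have [m m0 Vm] := sublevel_near0 V_posdef V_radial V_C1 eta0.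
  have /cvgrPdist_lt/(_ _ m0)/nbhs_ballP[d /= d0 Vd] := C1_continuous V_C1 (x := 0).
  exists d => // x0 b xi x0d sol t bt; apply: Vm.
  apply: (le_lt_trans (decr _ _ _ _ sol bt)).
  have := Vd x0; rewrite -ball_normE /ball_/= sub0r normrN => /(_ x0d).
  by rewrite V_posdef.1 sub0r normrN ger0_norm// posdef_ge0.
(* [M] bounds [V] over the initial states; beyond radius [r'], [V] exceeds [M], so no solution gets
   there. *)
move=> r; have [M VM] := bounded_on_ball r (C1_continuous V_C1).
have [r' Vr'] := V_radial M.
exists r' => x0 b xi x0r sol t bt; rewrite leNgt; apply/negP => /Vr'.
by rewrite ltNge (le_trans (decr _ _ _ _ sol bt) (VM _ x0r)).
Qed.

Lemma EFxTS_of_equality :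
  along_solutions f g 0 (fun dV w => dV = w) V vf ->
  EFxTS f g 0 (pi / (2 * omega)).
Proof.
move=> aleq; have al : along_solutions f g 0 (fun dV w => dV <= w) V vf.
  move=> x0 b xi /aleq; apply: ae_imply => t alt t0 tb.
  by rewrite alt.
have fx := FxTS_of_decay (lexx 0) al; split => // x0 xi x0_neq0 sol.
have T0 : 0 <= pi / (2 * omega) :> R by rewrite divr_ge0 ?pi_ge0// mulr_ge0// ltW.
have hor (t : R) : 0 <= t -> horizon +oo%E t by move=> t0; split => //; exact: ltry.
pose A := [set tau : R | 0 <= tau /\ forall t, tau <= t -> xpart (xi t) = 0].
have AT : A (pi / (2 * omega)).
  split => // t Tt; have bt : horizon +oo%E t by apply: hor; lra.
  exact: (xpart_settles (lexx 0) al sol bt Tt).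
(* A time in [A] before [pi / (2 * omega)] would be a zero of [V] where [V] is still positive. *)
have lbA : lbound A (pi / (2 * omega)).
  move=> tau [tau0 Atau]; rewrite leNgt; apply/negP => tauT.
  have : 0 < vpath xi tau.
    have eq0 : epath xi 0 = 0 by rewrite (epath0 sol).
    apply: (v_gt0_before omega_gt0 alpha01 _ (vpath_abs_cont sol)
      (epath_abs_cont sol) _ (along_vpath al sol) eq0 _ _ (hor _ tau0) tauT).
    + by move=> s; exact: posdef_ge0.
    + by rewrite eq0.
    + by rewrite (vpath0 sol) V_posdef.2.
    + by apply: ae_imply (along_vpath aleq sol) => t dt t0 tb; have [] := dt t0 tb.
  by rewrite /vpath Atau// V_posdef.1 ltxx.
apply/eqP; rewrite eq_le; apply/andP; split.
  by apply: ge_inf => //; exists (pi / (2 * omega)).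
by apply: lb_le_inf => //; exists (pi / (2 * omega)).
Qed.

End Coupled.
End Solutions.

Unset Implicit Arguments.

Theorem lemma2 (R : realType) (n : nat)
    (f : R -> 'rV[R]_n -> R -> 'rV[R]_n)
    (V : 'rV[R]_n -> R) (omega alpha : R)
    (omega_gt0 : 0 < omega) (alpha_gt0 : 0 < alpha) (alpha_lt1 : alpha < 1)
    (V_posdef : positive_definite V)
    (V_radial : radially_unbounded V)
    (V_C1 : continuously_differentiable V) :
  let g := fun (_ : R) (x : 'rV[R]_n) => omega * V x `^ alpha in
  let vf := fun (e : R) (x : 'rV[R]_n) =>
    - (omega / alpha) * e * V x `^ (1 - alpha) in
  locally_ess_bounded (coupled_rhs f g) ->
  locally_measurable (coupled_rhs f g) ->
  zero_equilibrium f g ->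
  (forall e0 : R, 0 <= e0 ->
     along_solutions f g e0 (fun dV w => dV <= w) V vf ->
     FxTS f g e0 (pi / (2 * omega))) /\
  (along_solutions f g 0 (fun dV w => dV = w) V vf ->
     EFxTS f g 0 (pi / (2 * omega))).
Proof.
move=> g vf _ _ _; have alpha01 : 0 < alpha < 1 by rewrite alpha_gt0.
split=> [e0 e0_ge0|]; first exact: FxTS_of_decay.
exact: EFxTS_of_equality.
Qed.
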